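(* Let $\ell$ be a positive integer. If $n_1$, $n_2$, and $n_3$ are positive integers such that $n_1\ge n_2\ge n_3\ge 32(\ell-1)^3+40(\ell-1)^2+11(\ell-1)$, then $$\operatorname{sat}(K_{n_1,n_2,n_3},K_{\ell,\ell,\ell-1})=2(\ell-1)(n_1+n_2+n_3)-3(\ell-1)^2.$$ Furthermore, the graph $G_3$ defined in the context is, up to isomorphism, the unique $K_{\ell,\ell,\ell-1}$-saturated subgraph of $K_{n_1,n_2,n_3}$ with this number of edges.
   Context: All graphs are simple, and $[k]=\{1,\dots,k\}$. For graphs $F$ and $H$, a subgraph $G$ of $H$ (with $V(G)=V(H)$) is an $F$-saturated subgraph of $H$ if $G$ contains no copy of $F$ as a (not necessarily induced) subgraph, but $G+e$ contains a copy of $F$ for every $e\in E(H)\setminus E(G)$. The number $\operatorname{sat}(H,F)$ is the minimum number of edges in an $F$-saturated subgraph of $H$. The host graph $K_{n_1,n_2,n_3}$ is the complete tripartite graph with partite sets $V_1,V_2,V_3$, $|V_i|=n_i$. The graph $K_{a,b,c}$ is the complete tripartite graph with part sizes $a,b,c$ (for $c=0$ this is the complete bipartite graph $K_{a,b}$). Arithmetic in subscripts is modulo 3 (with values in $[3]$). Graph $G_3$: for each $i\in[3]$ let $S_i$ be an $(\ell-1)$-vertex subset of $V_i$, and join every vertex of $S_i$ to all vertices of $V_{i+1}\cup V_{i+2}$; there are no other edges. *)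

(* Defs.v *)
From mathcomp Require Import all_boot order perm ssralg zmodp.

Set Implicit Arguments.
Unset Strict Implicit.
Unset Printing Implicit Defensive.

Import Order.TTheory GRing.Theory.

(* A graph with vertex set V is given by its edge set, a set of 2-subsets
   of V. *)
Notation graph V := {set {set V}}.

Definition simple (V : finType) (G : graph V) : bool :=
  [forall e in G, #|e| == 2].

Definition contains (V W : finType) (G : graph V) (F : graph W) : bool :=
  [exists f : {ffun W -> V}, injectiveb f && [forall e in F, f @: e \in G]].

Definition isomorphic (V : finType) (G G' : graph V) : bool :=
  [exists f : {perm V}, [set f @: (e : {set V}) | e in G] == G'].

Definition saturated (V W : finType) (H : graph V) (F : graph W)
    (G : graph V) : bool :=
  [&& G \subset H, ~~ contains G F
    & [forall e in H :\: G, contains (e |: G) F]].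

(* The default value #|H| is irrelevant as soon as some F-saturated subgraph
   of H exists, since none has more than #|H| edges; see satP. *)
Definition sat (V W : finType) (H : graph V) (F : graph W) : nat :=
  \big[minn/#|H|]_(G : graph V | saturated H F G) #|G|.

Lemma satP (V W : finType) (H : graph V) (F : graph W) (G0 : graph V) :
  saturated H F G0 ->
  (exists2 G : graph V, saturated H F G & sat H F = #|G|) /\
  (forall G : graph V, saturated H F G -> sat H F <= #|G|).
Proof.
move=> G0sat.
have sat_le (G : graph V) : saturated H F G -> sat H F <= #|G|.
  by move=> Gsat; rewrite -leEnat; exact: (@bigmin_le_cond _ nat).
split=> //; have [G Gsat Gmin] := arg_minnP (fun G : graph V => #|G|) G0sat.
exists G => //; apply/eqP; rewrite eqn_leq sat_le //=.
rewrite /sat; elim/big_ind: _ => //.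
- by case/and3P: Gsat => /subset_leq_card.
- by move=> m n leGm leGn; rewrite leq_min leGm leGn.
Qed.

Definition sizes3 (a b c : nat) (i : 'I_3) : nat := nth 0 [:: a; b; c] i.

(* The i-th partite set, i : 'I_3, is the set of pairs with first component
   i; addition on 'I_3 is modulo 3. *)
Definition tri_vertex (a b c : nat) : finType :=
  {i : 'I_3 & 'I_(sizes3 a b c i)}.

Definition part (a b c : nat) (i : 'I_3) : {set tri_vertex a b c} :=
  [set x | tag x == i].

Definition complete_tripartite (a b c : nat) : graph (tri_vertex a b c) :=
  [set [set x; y] | x in [set: tri_vertex a b c],
                    y in [set: tri_vertex a b c] & tag x != tag y].

Lemma complete_tripartite_simple (a b c : nat) :
  simple (complete_tripartite a b c).
Proof.
apply/forall_inP=> e /imset2P[x y _]; rewrite !inE /= => neq_xy ->.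
by rewrite cards2; case: (eqVneq x y) neq_xy => // ->; rewrite eqxx.
Qed.

Lemma card_part (a b c : nat) (i : 'I_3) : #|part a b c i| = sizes3 a b c i.
Proof.
pose t (j : 'I_(sizes3 a b c i)) : tri_vertex a b c :=
  Tagged (fun k => 'I_(sizes3 a b c k)) j.
have t_inj : injective t.
  by move=> j k /eqP; rewrite -tag_eqE /tag_eq /= eqxx tagged_asE => /eqP.
rewrite -[RHS]card_ord -cardsT -(card_imset _ t_inj).
apply: eq_card => -[k j]; rewrite inE /=.
apply/eqP/imsetP => [eq_ki | [j' _ /(congr1 tag)] //].
by subst k; exists j.
Qed.

Definition core_choice (a b c m : nat)
    (S : 'I_3 -> {set tri_vertex a b c}) : Prop :=
  forall i, S i \subset part a b c i /\ #|S i| = m.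

Lemma core_choice_exists (a b c m : nat) :
  m <= a -> m <= b -> m <= c ->
  exists S : 'I_3 -> {set tri_vertex a b c}, core_choice m S.
Proof.
move=> lema lemb lemc.
suff ex_S (i : 'I_3) : exists A : {set tri_vertex a b c},
    A \subset part a b c i /\ #|A| = m.
  by have [S SP] := fin_all_exists ex_S; exists S.
have /card_geqP[s [s_uniq <- s_sub]] : m <= #|part a b c i|.
  by rewrite card_part; case: i => -[|[|[|]]].
exists [set x in s]; split; first by apply/subsetP=> x /[!inE] /s_sub /[!inE].
by rewrite cardsE; apply/card_uniqP.
Qed.

Definition G3 (a b c : nat) (S : 'I_3 -> {set tri_vertex a b c}) :
    graph (tri_vertex a b c) :=
  \bigcup_(i : 'I_3) [set [set x; y] | x in S i,
     y in part a b c (i + 1)%R :|: part a b c (i + 2%:R)%R].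

(* Main.v *)
Require Import Defs.
From mathcomp Require Import all_boot order perm ssralg zmodp.
From mathcomp Require Import zify.

(** Write m = l - 1 and suppose m > 0, since for m = 0 the forbidden graph is a
    single edge. Let V_1, V_2, V_3 be the parts, of sizes n_1 >= n_2 >= n_3.

    Up to a renaming of the colours, K_{m+1,m+1,m} has only one proper
    3-colouring, so each copy of it in a tripartite graph has its three classes
    in the three parts ([contains_copy]). If u and v are nonadjacent vertices
    of a saturated graph G that lie in different parts, then the copy created
    by the edge uv shows that u and v have at least m common neighbours in the
    third part and that both have degree at least 2m ([codegree]).

    These bounds force the structure of [G3] as soon as G has three pairwise
    nonadjacent vertices of degree exactly 2m, one in each part
    ([core_of_triple]): all inequalities are then equalities, the neighbours
    of the three vertices form an m-set in each part, and each vertex of G is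
    joined to the m-sets of the two parts other than its own. So G contains a
    graph [G3 S]. As [G3 S] is itself saturated ([G3_saturated]), an edge of G
    outside [G3 S] would create a copy inside G, and thus G = [G3 S].

    It remains to find such a triple in every saturated graph with at most
    2m(n_1 + n_2 + n_3) edges. Let u in V_j and v in V_k have small degree, and
    let w have the least degree D among the vertices of V_i that are
    nonadjacent to both. By [codegree], the edges between V_k and N(u), those
    between V_j and N(v), and those between V_j and V_k together number about
    2m(n_j + n_k), so that only about 2m n_i edges are left for V_i outside N(u)
    and N(v). Hence D = 2m ([low_degree]). Three applications of this turn one
    vertex of small degree in V_1 and one in V_2 into the triple.

    In V_1, averaging gives a vertex of degree at most 4m. In V_2 it does not,
    because the average degree there may grow with n_1 / n_2. Choose instead
    m + 1 vertices of V_3 with few neighbours in V_2, and let Y be the set of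
    these neighbours ([few_neighbours]). A vertex of V_1 has m neighbours in Y
    unless it is joined to all m + 1 chosen vertices, and in both cases its
    number of neighbours in V_2 outside Y is at most m + 1 times the excess of
    its degree over 2m ([excess_bound]). The total excess over V_1 is O(m n_2),
    so averaging over V_2 outside Y gives a vertex whose degree is bounded in
    terms of m alone ([small_degree_middle_part]). *)

Set Implicit Arguments.
Unset Strict Implicit.
Unset Printing Implicit Defensive.

(** * The three parts *)

Definition distinct3 (i j k : 'I_3) : bool := [&& i != j, i != k & j != k].

Lemma distinct3_ex (i j : 'I_3) : i != j -> exists k, distinct3 i j k.
Proof.
move=> ij; suff: [exists k, distinct3 i j k] by move/existsP.
by apply/existsP; case: i j ij => [[|[|[|?]]] ?] // [[|[|[|?]]] ?] // _;
  first [by exists (inord 0); rewrite /distinct3 -!val_eqE /= !inordK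
        | by exists (inord 1); rewrite /distinct3 -!val_eqE /= !inordK
        | by exists (inord 2); rewrite /distinct3 -!val_eqE /= !inordK].
Qed.

Lemma distinct3C i j k : distinct3 i j k = distinct3 j i k.
Proof. by rewrite /distinct3 (eq_sym j i) (andbC (i != k)). Qed.

Lemma distinct3_rot i j k : distinct3 i j k = distinct3 j k i.
Proof.
by rewrite /distinct3 (eq_sym j i) (eq_sym k i); do 3!case: (_ == _).
Qed.

Lemma distinct3_cover i j k c : distinct3 i j k -> [|| c == i, c == j | c == k].
Proof.
by case: i j k c => [[|[|[|?]]] ?] // [[|[|[|?]]] ?] // [[|[|[|?]]] ?] //
  [[|[|[|?]]] ?].
Qed.

Lemma distinct3_setC (i j k : 'I_3) : distinct3 i j k -> [set~ i] = [set j; k].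
Proof.
move=> o; apply/setP=> c; rewrite !inE.
case/and3P: (o) => ij ik _; have := distinct3_cover c o.
by case: (eqVneq c i) => [-> | _ /= ->] //; rewrite (negPf ij) (negPf ik).
Qed.

Lemma sum_distinct3 (i j k : 'I_3) (f : 'I_3 -> nat) :
  distinct3 i j k -> \sum_c f c = f i + f j + f k.
Proof.
move=> o; rewrite (bigD1 i) //= -addnA; congr (_ + _).
rewrite (eq_bigl (mem [set j; k])) => [|c]; last first.
  by rewrite -(distinct3_setC o) !inE.
by case/and3P: o => _ _ jk; rewrite big_setU1 ?inE // big_set1.
Qed.

(** * Neighbourhoods and edge counts in tripartite graphs *)

Lemma set2_eq (T : finType) (a b c d : T) :
  [set a; b] = [set c; d] -> (a = c /\ b = d) \/ (a = d /\ b = c).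
Proof.
move=> e.
have ha : a \in [set c; d] by rewrite -e !inE eqxx.
have hb : b \in [set c; d] by rewrite -e !inE eqxx orbT.
have hc : c \in [set a; b] by rewrite e !inE eqxx.
have hd : d \in [set a; b] by rewrite e !inE eqxx orbT.
move: ha hb hc hd; rewrite !inE.
by do 4!(case/orP=> /eqP ?); subst; auto.
Qed.

Section Neighbours.
Variables (a b c : nat).
Let V := tri_vertex a b c.
Implicit Types (G : graph V) (x y : V).

Lemma mem_complete_tripartite x y :
  ([set x; y] \in complete_tripartite a b c) = (tag x != tag y).
Proof.
apply/imset2P/idP => [[u v _]|txy]; last first.
  by exists x y; rewrite ?inE.
rewrite !inE /= => tuv /set2_eq[] [-> ->] //; by rewrite eq_sym.
Qed.

Definition nbr G x : {set V} := [set y | [set x; y] \in G].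
Definition nbr_in G x i : {set V} := nbr G x :&: part a b c i.
Definition deg_in G x i : nat := #|nbr_in G x i|.
Definition edges_between G i j : nat := \sum_(x in part a b c i) deg_in G x j.

Lemma nbrE G x y : (y \in nbr G x) = ([set x; y] \in G).
Proof. by rewrite inE. Qed.

Lemma nbrC G x y : (y \in nbr G x) = (x \in nbr G y).
Proof. by rewrite !inE setUC. Qed.

Lemma card_sum_nbr (X Y : {set V}) G :
  \sum_(x in X) #|nbr G x :&: Y| = \sum_(y in Y) #|nbr G y :&: X|.
Proof.
have E Z x : #|nbr G x :&: Z| = \sum_(y in Z) (y \in nbr G x).
  rewrite -sum1_card big_mkcond [RHS]big_mkcond; apply: eq_bigr => y _.
  by rewrite inE; case: (y \in nbr G x); case: (y \in Z).
under eq_bigr => x _ do rewrite E.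
under [RHS]eq_bigr => y _ do rewrite E.
rewrite exchange_big; apply: eq_bigr => y _; apply: eq_bigr => x _.
by rewrite nbrC.
Qed.

Lemma edges_betweenC G i j : edges_between G i j = edges_between G j i.
Proof. exact: card_sum_nbr. Qed.

Lemma card_nbr_sum G x : #|nbr G x| = \sum_i deg_in G x i.
Proof.
rewrite -sum1_card (partition_big (fun y : V => tag y) predT) //=.
apply: eq_bigr => i _; rewrite /deg_in -sum1_card; apply: eq_bigl => y.
by rewrite !inE.
Qed.

(** Both sides count the pairs of a vertex and an edge containing it. *)
Lemma handshake G : simple G -> \sum_x #|nbr G x| = #|G|.*2.
Proof.
move=> /forall_inP sG.
have E x : #|nbr G x| = \sum_(e in G) (x \in e).
  have <- : #|[set [set x; y] | y in nbr G x]| = #|nbr G x|.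
    by rewrite card_imset // => y z /set2_eq[[] //|[<- <-]].
  rewrite -sum1_card [RHS]big_mkcond /= [LHS]big_mkcond /=.
  apply: eq_bigr => e _; case: imsetP => [[y] | nex].
    by rewrite inE => xy ->; rewrite xy !inE eqxx.
  case: ifP => // eG; case: (boolP (x \in e)) => // xe; case: nex.
  have /cards2P[u [v [_ E]]] := sG e eG.
  move: xe; rewrite E !inE => /orP[]/eqP->; [exists v|exists u] => //.
  - by rewrite inE -E.
  - by rewrite inE setUC -E.
  - by rewrite setUC.
under eq_bigr => x _ do rewrite E.
rewrite exchange_big /= -mul2n mulnC -sum_nat_const; apply: eq_bigr => e eG.
transitivity #|e|; last exact: (eqP (sG e eG)).
rewrite -sum1_card [RHS]big_mkcond.
by apply: eq_bigr => x _; case: (x \in e).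
Qed.

Variable G : graph V.
Hypothesis GH : G \subset complete_tripartite a b c.

Lemma nbr_tag x y : y \in nbr G x -> tag x != tag y.
Proof. by rewrite inE => /(subsetP GH); rewrite mem_complete_tripartite. Qed.

Lemma deg_in_own x : deg_in G x (tag x) = 0.
Proof.
apply/eqP; rewrite cards_eq0; apply/eqP/setP=> y; rewrite !inE.
apply/negP=> /andP[yx /eqP yt].
by have := @nbr_tag x y; rewrite inE yx yt eqxx => /(_ isT).
Qed.

Lemma card_nbr x i j k :
  distinct3 i j k -> x \in part a b c i ->
  #|nbr G x| = deg_in G x j + deg_in G x k.
Proof.
move=> o; rewrite inE => /eqP ti.
by rewrite card_nbr_sum (sum_distinct3 _ o) -ti deg_in_own.
Qed.

Lemma card_edges_pairs i j k :
  distinct3 i j k ->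
  #|G| = edges_between G i j + edges_between G i k + edges_between G j k.
Proof.
move=> o.
have sG : simple G.
  apply/forall_inP=> e /(subsetP GH).
  by have /forall_inP := complete_tripartite_simple a b c; apply.
apply: double_inj; rewrite -(handshake sG).
rewrite (partition_big (fun y : V => tag y) predT) //= (sum_distinct3 _ o).
have S i' j' k' : distinct3 i' j' k' ->
    \sum_(x | tag x == i') #|nbr G x|
      = edges_between G i' j' + edges_between G i' k'.
  move=> o'; rewrite /edges_between -big_split.
  apply: eq_big => x; first by rewrite inE.
  by move=> tx; apply: (card_nbr o'); rewrite inE.
have o2 : distinct3 j k i by rewrite -distinct3_rot.
have o3 : distinct3 k i j by rewrite -distinct3_rot.
rewrite (S _ _ _ o) (S _ _ _ o2) (S _ _ _ o3).
rewrite (edges_betweenC G j i) (edges_betweenC G k i) (edges_betweenC G k j).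
by do 3!move: (edges_between G _ _) => ?; lia.
Qed.

End Neighbours.

(** * Copies of the forbidden graph *)

(** A copy of K_{m+1,m+1,m} given by its classes, indexed by the part of the
    host that contains them; [k] is the part with the class of size [m]. *)
Definition tripartite_copy (a b c m : nat) (G : graph (tri_vertex a b c))
    (k : 'I_3) (A : 'I_3 -> {set tri_vertex a b c}) : Prop :=
  [/\ forall i, A i \subset part a b c i,
      forall i, #|A i| = if i == k then m else m.+1
    & forall i j x y, i != j -> x \in A i -> y \in A j -> [set x; y] \in G].

(** A proper 3-colouring of a complete tripartite graph with nonempty parts
    gives different colours to one representative of each part; every other
    vertex then has only the colour of its representative left. *)
Lemma colouring_perm (p q r : nat) (c : tri_vertex p q r -> 'I_3) :
  0 < p -> 0 < q -> 0 < r ->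
  (forall v w, tag v != tag w -> c v != c w) ->
  exists s : {perm 'I_3}, forall v, c v = s (tag v).
Proof.
move=> p0 q0 r0 cP.
have pos i : 0 < sizes3 p q r i by case: i => [[|[|[|]]]].
pose rep i : tri_vertex p q r :=
  Tagged (fun i => 'I_(sizes3 p q r i)) (Ordinal (pos i)).
have rep_inj : injective (fun i => c (rep i)).
  move=> i j eq_c; apply/eqP; apply: contraT => ij.
  by have := cP (rep i) (rep j) ij; rewrite eq_c eqxx.
exists (perm rep_inj) => v; rewrite permE.
have /codomP[j cv] : c v \in codom (fun i => c (rep i)).
  by rewrite inj_card_onto.
rewrite cv; congr (c (rep _)); apply/eqP; rewrite eq_sym; apply: contraT => vj.
by have := cP v (rep j) vj; rewrite cv eqxx.
Qed.

Lemma sizes3E m i : sizes3 m.+1 m.+1 m i = if i == ord_max then m else m.+1.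
Proof. by case: i => [[|[|[|]]]]. Qed.

Section Copies.
Variables a b c m : nat.
Let V := tri_vertex a b c.
Let F := complete_tripartite m.+1 m.+1 m.
Implicit Type G : graph V.

Lemma contains_copy G : 0 < m -> G \subset complete_tripartite a b c ->
  contains G F -> exists k A, tripartite_copy m G k A.
Proof.
move=> m0 GH /existsP[f /andP[/injectiveP f_inj /forall_inP fF]].
have fG v w : tag v != tag w -> [set f v; f w] \in G.
  move=> vw; have <- : f @: [set v; w] = [set f v; f w].
    by rewrite imsetU !imset_set1.
  by rewrite fF // mem_complete_tripartite.
have [|s fs] := @colouring_perm m.+1 m.+1 m (fun v => tag (f v)) isT isT m0.
  by move=> v w /fG/(subsetP GH); rewrite mem_complete_tripartite.
exists (s ord_max), (fun i => f @: part m.+1 m.+1 m (s^-1 i)%g); split.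
- move=> i; apply/subsetP=> _ /imsetP[v + ->]; rewrite !inE fs.
  by move=> /eqP->; rewrite permKV.
- move=> i; rewrite card_imset // card_part sizes3E.
  by rewrite (can2_eq (permKV s) (permK s)).
- move=> i j _ _ ij /imsetP[v vi ->] /imsetP[w wj ->]; apply: fG.
  by move: vi wj; rewrite !inE => /eqP-> /eqP->; rewrite (inj_eq perm_inj).
Qed.

Lemma copy_contains G k A : tripartite_copy m G k A -> contains G F.
Proof.
case=> Ap Ac AG; pose s := tperm k ord_max.
have sz i : #|A (s i)| = sizes3 m.+1 m.+1 m i.
  rewrite Ac sizes3E; congr (if _ then _ else _).
  by rewrite -[X in s i == X](tpermR k ord_max) (inj_eq perm_inj).
have /card_gt0P[x0 _] : 0 < #|A (s ord0)| by rewrite sz.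
pose f (v : tri_vertex m.+1 m.+1 m) : V :=
  nth x0 (enum (A (s (tag v)))) (tagged v).
have lt_f (v : tri_vertex m.+1 m.+1 m) : tagged v < size (enum (A (s (tag v)))).
  by rewrite -cardE sz ltn_ord.
have fA v : f v \in A (s (tag v)) by rewrite -mem_enum mem_nth.
have ft v : tag (f v) = s (tag v).
  by apply/eqP; have := subsetP (Ap _) _ (fA v); rewrite inE.
have f_inj : injective f.
  move=> v w eq_f; have := congr1 tag eq_f; rewrite !ft => /perm_inj.
  move: v w eq_f (lt_f v) (lt_f w) => [i v] [j w] + + + /= eq_ij; subst j.
  rewrite /f /= => /eqP eq_f ltv ltw; move: eq_f.
  by rewrite nth_uniq ?enum_uniq // => /eqP/val_inj->.
apply/existsP; exists (finfun f); apply/andP; split.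
  by apply/injectiveP=> v w; rewrite !ffunE => /f_inj.
apply/forall_inP=> e /imset2P[v w _]; rewrite inE => vw ->.
rewrite imsetU !imset_set1 !ffunE; apply: (AG _ _ _ _ _ (fA v) (fA w)).
by rewrite (inj_eq perm_inj); move: vw; rewrite inE.
Qed.

Variable G : graph V.
Hypothesis m_gt0 : 0 < m.
Hypothesis Gsat : saturated (complete_tripartite a b c) F G.

Lemma saturated_sub : G \subset complete_tripartite a b c.
Proof. by case/and3P: Gsat. Qed.

Lemma saturated_copy x y : tag x != tag y -> y \notin nbr G x ->
  exists k A, [/\ tripartite_copy m ([set x; y] |: G) k A,
                 x \in A (tag x) & y \in A (tag y)].
Proof.
move=> xy nxy; have /and3P[GH FG /forall_inP FeG] := Gsat.
have xyH : [set x; y] \in complete_tripartite a b c.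
  by rewrite mem_complete_tripartite.
have /FeG : [set x; y] \in complete_tripartite a b c :\: G.
  by rewrite inE xyH andbT; move: nxy; rewrite inE.
move=> /contains_copy[] // => [|k [A AP]].
  by rewrite subUset sub1set xyH.
exists k, A; case: (AP) => Ap Ac AG.
have [/andP[? ?]|nA] := boolP ((x \in A (tag x)) && (y \in A (tag y))) => //.
case/negP: FG; apply: (@copy_contains _ k A); split=> // i j u v ij ui vj.
have := AG i j u v ij ui vj; rewrite !inE => /orP[/eqP E|//].
have /[!inE]/eqP tu := subsetP (Ap _) _ ui.
have /[!inE]/eqP tv := subsetP (Ap _) _ vj.
by case/negP: nA; case/set2_eq: E => -[? ?]; subst; rewrite ui vj.
Qed.

(** The form in which saturation is used. The index of the smallest class is
    unknown, which leaves the bounds m for one class and 2m + 1 for two. *)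
Lemma saturated_copyP x y i j k : distinct3 i j k ->
  x \in part a b c i -> y \in part a b c j -> y \notin nbr G x ->
  exists X Y Z : {set V},
    [/\ [/\ X \subset part a b c i, Y \subset part a b c j,
            Z \subset part a b c k, x \in X & y \in Y],
        [/\ m <= #|X|, m <= #|Y|, m <= #|Z|, m.*2.+1 <= #|X| + #|Y|
          & m.*2.+1 <= #|X| + #|Z| /\ m.*2.+1 <= #|Y| + #|Z|]
      & [/\ forall u v, u \in X -> v \in Z -> v \in nbr G u,
            forall u v, u \in Y -> v \in Z -> v \in nbr G u
          & forall u v, u \in X -> v \in Y -> (u, v) != (x, y) ->
              v \in nbr G u]].
Proof.
move=> o xi yj nxy; case/and3P: (o) => ij ik jk.
move: (xi) (yj); rewrite !inE => /eqP ti /eqP tj.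
have [|k' [A [[Ap Ac AG]]]] := @saturated_copy x y _ nxy.
  by rewrite ti tj.
rewrite ti tj => xA yA; exists (A i), (A j), (A k).
have tA u c' : u \in A c' -> tag u = c'.
  by move/(subsetP (Ap _)); rewrite inE => /eqP.
have A1 p : m <= #|A p| by rewrite Ac; case: ifP.
have A2 p q : p != q -> m.*2.+1 <= #|A p| + #|A q|.
  move=> pq; rewrite !Ac; case: (eqVneq p k') => [pk|_].
    by rewrite -pk eq_sym (negPf pq) addnS addnn.
  by case: ifP => _; rewrite ?addnS addSn addnn // ltnS leqnSn.
split; first by split.
- by split; rewrite ?A1 // ?A2 //; split; apply: A2.
- split=> u v uA vA; rewrite inE.
  + have := AG i k u v ik uA vA; rewrite !inE => /orP[/eqP/set2_eq|//].
    case=> -[Eu Ev]; have := tA _ _ vA; rewrite Ev ?ti ?tj => /eqP.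
      by rewrite (negPf jk).
    by rewrite (negPf ik).
  + have := AG j k u v jk uA vA; rewrite !inE => /orP[/eqP/set2_eq|//].
    case=> -[Eu Ev]; have := tA _ _ vA; rewrite Ev ?ti ?tj => /eqP.
      by rewrite (negPf jk).
    by rewrite (negPf ik).
  + move=> uv; have := AG i j u v ij uA vA.
    rewrite !inE => /orP[/eqP/set2_eq|//].
    case=> -[Eu Ev]; first by rewrite Eu Ev eqxx in uv.
    by have := tA _ _ uA; rewrite Eu tj => /eqP; rewrite eq_sym (negPf ij).
Qed.

End Copies.

(** * Arithmetic of the counting inequalities *)

(** In these lemmas [ni], [nj], [nk] are the sizes of the parts, [E] is the
    number of edges, [ejk] counts the edges between two parts, and [Si] the
    edges at the third. Here [w] is the number of vertices left in that part,
    [D] their least degree, [p], [q], [r], [s] are the numbers of neighbours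
    of the two given vertices, and [t1], [t2] count the edges at the
    neighbours of each of them. *)
Lemma low_degree_arith m ni nj nk w p q r s D Si ejk t1 t2 E :
  (2 * m + 1) * ((p + r) + (q + s) + m) < ni -> ni <= w + (p + q) ->
  m * nk <= t1 + m * r -> m * nj <= t2 + m * s ->
  m * (nj + nk) <= ejk + m * D -> w * D + t1 + t2 <= Si -> E = Si + ejk ->
  E <= 2 * m * (ni + nj + nk) -> D <= 2 * m.
Proof.
move=> h1 h2 h3 h4 h5 h6 h7 h8; rewrite leqNgt; apply/negP=> h9.
have wm : m <= w by lia.
have [t Et] : exists t, w = t + m by exists (w - m); rewrite subnK.
subst w.
have h10 : t * (2 * m + 1) <= t * D by rewrite leq_mul2l; lia.
have h11 : t * D <= 2 * m * ni + m * (r + s) by lia.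
have h12 : ni * (2 * m + 1) <= (t + m + (p + q)) * (2 * m + 1).
  by rewrite leq_mul2r h2 orbT.
lia.
Qed.

Lemma largest_part_arith m ni nj nk D Si ejk E :
  nj <= ni -> nk <= ni -> m * (4 * m + 1) < ni ->
  ni * D <= Si -> E = Si + ejk -> m * (nj + nk) <= ejk + m * D ->
  E <= 2 * m * (ni + nj + nk) -> D <= 4 * m.
Proof.
move=> h1 h2 h3 h4 h5 h6 h7; rewrite leqNgt; apply/negP=> h8.
have [t Et] : exists t, ni = t + m by exists (ni - m); rewrite subnK; lia.
have h9 : t * (4 * m + 1) <= t * D by rewrite leq_mul2l; lia.
have h10 : m * nj <= m * ni by rewrite leq_mul2l h1 orbT.
have h11 : m * nk <= m * ni by rewrite leq_mul2l h2 orbT.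
subst ni; lia.
Qed.

(** The average number of neighbours is at most 4 m nj / nk; [bad] counts the
    vertices with more than twice as many. *)
Lemma few_bad_arith m nj nk ejk bad :
  0 < m -> 0 < nj -> nk <= nj -> bad * (8 * m * nj) <= nk * ejk ->
  ejk <= 2 * m * (nj + nk) -> 2 * bad <= nk.
Proof.
move=> h0 h1 h2 h3 h4.
have h6 : m * nk <= m * nj by rewrite leq_mul2l h2 orbT.
have h5 : nk * ejk <= nk * (4 * m * nj) by rewrite leq_mul2l; lia.
have : (2 * bad) * (4 * m * nj) <= nk * (4 * m * nj) by lia.
by rewrite leq_pmul2r // !muln_gt0 h0.
Qed.

(** Here [y] bounds the neighbours of m + 1 vertices having 8 m nj / nk
    neighbours each. *)
Lemma quarter_arith m nj nk y :
  32 * m ^ 2 + 32 * m <= nk -> 0 < nk ->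
  nk * y <= m.+1 * (8 * m * nj) -> 4 * y <= nj.
Proof.
rewrite expnS expn1 => h1 h2 h3.
have h4 : (32 * (m * m) + 32 * m) * nj <= nk * nj by rewrite leq_mul2r h1 orbT.
have : nk * (4 * y) <= nk * nj by lia.
by rewrite leq_pmul2l.
Qed.

(** Here [s1] counts the edges between the two largest parts that avoid [y]
    exceptional vertices of the second, and [B] is the least degree among its
    other vertices. *)
Lemma middle_part_arith m ni nj nk y B Si ejk E s1 :
  0 < m -> nk <= nj -> m <= nj -> 4 * y <= nj ->
  s1 + m.+1 * (2 * m) * ni <= m.+1 * Si ->
  (nj - y) * B <= s1 + ejk -> E = Si + ejk ->
  m * (nj + nk) <= ejk + m * (4 * m) ->
  E <= 2 * m * (ni + nj + nk) -> B <= 10 * m ^ 2 + 5 * m.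
Proof.
rewrite expnS expn1 => h0 h1 h2 h3 h4 h5 h6 h7 h8.
rewrite leqNgt; apply/negP=> h9.
have h10 : (3 * nj) * (10 * (m * m) + 5 * m) <= 4 * (nj - y) * B.
  by apply: leq_mul; lia.
have h13 : m * (m * (nj + nk)) <= m * (ejk + m * (4 * m)).
  by rewrite leq_mul2l h7 orbT.
have h14 : m * (m * nk) <= m * (m * nj) by rewrite !leq_mul2l h1 !orbT.
have h15 : m * E <= m * (2 * m * (ni + nj + nk)).
  by rewrite leq_mul2l h8 orbT.
have h16 : m * nk <= m * nj by rewrite leq_mul2l h1 orbT.
have h11 : s1 + ejk <= (2 * (m * m) + 4 * m) * nj + 4 * (m * m * m).
  by subst E; lia.
have h12 : m * m * m <= m * m * nj by rewrite leq_mul2l h2 orbT.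
have h17 : m * nj <= m * m * nj by rewrite leq_mul2r leq_pmull ?orbT.
have h18 : 0 < m * m * nj by rewrite !muln_gt0 h0 (leq_trans h0).
lia.
Qed.

(** The four cases arise in the proof of [excess_bound] below: a vertex has [t]
    and [u] neighbours in the two other parts, and [q] of the [t] lie outside
    an exceptional set. *)
Lemma excess_arith m q t u :
  0 < m -> q <= t ->
  [\/ q + m <= t /\ m <= u, [/\ q + m <= t, m <= u.+1 & m.+2 <= t],
     m < u /\ m <= t | 2 * m <= u] ->
  q + m.+1 * (2 * m) <= m.+1 * (t + u).
Proof.
move=> m0 qt H.
suff : q <= m.+1 * (t + u - 2 * m) /\ 2 * m <= t + u.
  case=> h1 h2; have [d E] : exists d, t + u = 2 * m + d.
    by exists (t + u - 2 * m); rewrite subnKC.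
  by move: h1; rewrite E addKn; lia.
case: H => [[h1 h2]|[h1 h2 h3]|[h1 h2]|h1]; split; try lia.
- by apply: (leq_trans _ (leq_pmull _ _)) => //; lia.
- have [d E] : exists d, t + u - 2 * m = d.+1 by exists (t + u - 2 * m).-1; lia.
  by rewrite E; have := leq_pmull d (ltn0Sn m); lia.
- have [d E] : exists d, t + u - 2 * m = d.+1 by exists (t + u - 2 * m).-1; lia.
  by rewrite E; have := leq_pmull d (ltn0Sn m); lia.
- by apply: (leq_trans _ (leq_pmull _ _)) => //; lia.
Qed.

Lemma low_degree_threshold m p q n :
  32 * m ^ 3 + 40 * m ^ 2 + 11 * m <= n -> 0 < m ->
  p <= 10 * m ^ 2 + 5 * m -> q <= 4 * m ->
  (2 * m + 1) * (p + q + m) < n.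
Proof.
rewrite !expnS expn0 muln1 => h1 h2 h3 h4.
have h5 : (2 * m + 1) * (p + q + m) <= (2 * m + 1) * (10 * (m * m) + 10 * m).
  by rewrite leq_mul2l; lia.
have h6 : 0 < m * (m * m) by rewrite !muln_gt0 h2.
lia.
Qed.

Lemma part_size_bounds m n :
  0 < m -> 32 * m ^ 3 + 40 * m ^ 2 + 11 * m <= n ->
  [/\ m * (4 * m + 1) < n, 32 * m ^ 2 + 32 * m <= n, m.+2 <= n & 2 * m <= n].
Proof.
rewrite !expnS expn0 muln1 => m0 h.
have h1 : m * m <= m * (m * m) by rewrite leq_mul2l leq_pmulr ?orbT.
have h2 : m <= m * m by rewrite leq_pmulr.
by split; lia.
Qed.

(** * Degrees in a saturated graph *)

Lemma leq_card_bigcup (I T : finType) (D : {set I}) (S : I -> {set T}) :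
  #|\bigcup_(i in D) S i| <= \sum_(i in D) #|S i|.
Proof.
elim/big_rec2: _ => [|i p X _ le_Xp]; first by rewrite cards0.
by rewrite (leq_trans (leq_card_setU _ _)) // leq_add2l.
Qed.

Section Saturated.
Variables a b c m : nat.
Let V := tri_vertex a b c.
Let n := sizes3 a b c.
Let P := part a b c.
Variable G : graph V.
Hypothesis m_gt0 : 0 < m.
Hypothesis Gsat :
  saturated (complete_tripartite a b c) (complete_tripartite m.+1 m.+1 m) G.

Let GH := saturated_sub Gsat.

Let cardP j : #|P j| = n j. Proof. exact: card_part. Qed.

(** The class in part k of the copy created by the edge xy consists of common
    neighbours of x and y. All vertices of the copy in the parts j and k other
    than y are neighbours of x; in part j there are at least m - 1 of them, and
    in both parts together at least 2m. *)
Lemma codegree i j k x y : distinct3 i j k ->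
  x \in P i -> y \in P j -> y \notin nbr G x ->
  [/\ m <= #|nbr G x :&: nbr_in G y k|, m <= (deg_in G x j).+1
    & 2 * m <= #|nbr G x|].
Proof.
move=> o xi yj nxy.
have [X [Y [Z [[_ Yj Zk xX yY] [_ Ym Zm _ [_ YZ]] [XZ YZa XY]]]]] :=
  saturated_copyP m_gt0 Gsat o xi yj nxy.
have Zsub : Z \subset nbr G x :&: nbr_in G y k.
  by apply/subsetP=> z zZ; rewrite in_setI XZ // in_setI YZa // (subsetP Zk).
have ZsubX : Z \subset nbr_in G x k.
  by apply/subsetP=> z zZ; rewrite in_setI XZ // (subsetP Zk).
have Ysub : Y :\ y \subset nbr_in G x j.
  apply/subsetP=> v; rewrite in_setD1 => /andP[vy vY].
  by rewrite in_setI (subsetP Yj) // andbT XY // xpair_eqE negb_and vy orbT.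
have Y1 : #|Y| = #|Y :\ y|.+1 by rewrite (cardsD1 y) yY.
move: (subset_leq_card Zsub) (subset_leq_card ZsubX) (subset_leq_card Ysub).
rewrite (card_nbr GH o xi) -/(deg_in G x j) -/(deg_in G x k) mul2n.
move: Y1 Ym Zm YZ.
move: #|Y| #|Y :\ y| #|Z| #|_ :&: _| (deg_in G x j) (deg_in G x k).
by clear; move=> y1 y2 z1 z2 d1 d2 *; split; lia.
Qed.

Lemma codegree_deg_in i j k x y : distinct3 i j k ->
  x \in P i -> y \in P j -> y \notin nbr G x -> m <= deg_in G x k.
Proof.
move=> o xi yj nxy; have [h _ _] := codegree o xi yj nxy.
apply: (leq_trans h); apply: subset_leq_card; apply/subsetP=> z.
by rewrite !in_setI => /and3P[-> _ ->].
Qed.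

Lemma deg_in_full x j : P j \subset nbr G x -> deg_in G x j = n j.
Proof. by move=> h; rewrite /deg_in /nbr_in (setIidPr h) card_part. Qed.

Lemma deg_or_full i j k x : distinct3 i j k -> x \in P i ->
  m <= deg_in G x k \/ deg_in G x j = n j.
Proof.
move=> o xi; have [/deg_in_full|] := boolP (P j \subset nbr G x).
  by right.
by case/subsetPn => y yj nxy; left; apply: (codegree_deg_in o xi yj nxy).
Qed.

Lemma leq_degree i j k x : distinct3 i j k -> x \in P i -> 2 * m <= n j ->
  2 * m <= #|nbr G x|.
Proof.
move=> o xi nj; have [/deg_in_full E|] := boolP (P j \subset nbr G x).
  by rewrite (card_nbr GH o xi) E (leq_trans nj) ?leq_addr.
by case/subsetPn => y yj nxy; have [] := codegree o xi yj nxy.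
Qed.

(** Each vertex of part k that is not adjacent to u has m neighbours among the
    neighbours of u in part j. *)
Lemma edges_from_neighbours i j k u : distinct3 i j k -> u \in P i ->
  m * n k <= \sum_(w in nbr_in G u j) deg_in G w k + m * deg_in G u k.
Proof.
move=> o ui.
have -> : \sum_(w in nbr_in G u j) deg_in G w k
    = \sum_(w in P k) #|nbr G w :&: nbr_in G u j| by exact: card_sum_nbr.
have -> : n k = #|P k :\: nbr G u| + deg_in G u k.
  by rewrite -cardP -(cardsID (nbr G u)) addnC setIC.
rewrite mulnDr leq_add2r mulnC -sum_nat_const.
rewrite [leqRHS](bigID (mem (P k :\: nbr G u))) /=.
apply: (leq_trans _ (leq_addr _ _)).
rewrite [leqRHS](eq_bigl (mem (P k :\: nbr G u))) => [|w]; last first.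
  by rewrite /= !inE andbC -andbA andbb.
apply: leq_sum => w; rewrite in_setD => /andP[nwu wk].
have o' : distinct3 k i j by rewrite distinct3_rot.
have nuw : u \notin nbr G w by rewrite nbrC.
have [h _ _] := codegree o' wk ui nuw.
exact: h.
Qed.

(** Split the edges by their ends in part j: those at neighbours of u are
    bounded in [edges_from_neighbours], and each other vertex has m neighbours
    in part k by [codegree_deg_in]. *)
Lemma edges_between_bound i j k u : distinct3 i j k -> u \in P i ->
  m * (n j + n k) <= edges_between G j k + m * #|nbr G u|.
Proof.
move=> o ui; rewrite (card_nbr GH o ui) !mulnDr.
have h1 := edges_from_neighbours o ui.
rewrite /edges_between (bigID (mem (nbr G u))) /=.
rewrite (eq_bigl (mem (nbr_in G u j))) => [|w]; last by rewrite /= !inE andbC.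
have h2 : m * n j <=
    \sum_(w in P j | w \notin nbr G u) deg_in G w k + m * deg_in G u j.
  have -> : n j = #|P j :\: nbr G u| + deg_in G u j.
    by rewrite -cardP -(cardsID (nbr G u)) addnC setIC.
  rewrite mulnDr leq_add2r mulnC -sum_nat_const.
  rewrite [leqRHS](eq_bigl (mem (P j :\: nbr G u))) => [|w]; last first.
    by rewrite /= !inE andbC.
  apply: leq_sum => w; rewrite in_setD => /andP[nwu wj].
  have o' : distinct3 j i k by rewrite -distinct3C.
  have nuw : u \notin nbr G w by rewrite nbrC.
  exact: codegree_deg_in o' wj ui nuw.
rewrite addnC (addnC (m * deg_in G u j)) addnACA; exact: leq_add.
Qed.

Lemma card_edges_at i j k : distinct3 i j k ->
  #|G| = \sum_(x in P i) #|nbr G x| + edges_between G j k.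
Proof.
move=> o; rewrite (card_edges_pairs GH o) /edges_between -big_split /=.
congr (_ + _).
by apply: eq_bigr => x xi; rewrite (card_nbr GH o xi).
Qed.

(** The vertices of part i in N(u) or N(v) and the edges between the parts j and
    k together use up about 2m(n j + n k) edges. If all vertices of W, the rest
    of part i, had degree at least 2m + 1, there would be too many edges. *)
Lemma low_degree i j k u v : distinct3 i j k -> u \in P j -> v \in P k ->
  #|G| <= 2 * m * (n i + n j + n k) -> 2 * m <= n j ->
  (2 * m + 1) * (#|nbr G u| + #|nbr G v| + m) < n i ->
  exists w, [/\ w \in P i, w \notin nbr G u, w \notin nbr G v
    & #|nbr G w| = 2 * m].
Proof.
move=> o uj vk Ele nj nbig.
have oj : distinct3 j i k by rewrite -distinct3C.
have ok : distinct3 k i j by rewrite distinct3_rot.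
pose W := P i :\: (nbr G u :|: nbr G v).
have cW : n i <= #|W| + (deg_in G u i + deg_in G v i).
  rewrite -cardP -(cardsID (nbr G u :|: nbr G v)) addnC leq_add2l.
  rewrite setIUr (leq_trans (leq_card_setU _ _)) //.
  by rewrite ![P i :&: _]setIC.
have [w0 w0W] : exists w0, w0 \in W.
  apply/card_gt0P; rewrite -(ltn_add2r (deg_in G u i + deg_in G v i)) add0n.
  apply: leq_trans cW; apply: leq_ltn_trans nbig.
  rewrite (card_nbr GH oj uj) (card_nbr GH ok vk).
  by clear; do 4!move: (deg_in _ _ _) => ?; lia.
have [w wW wmin] := arg_minnP (fun w => #|nbr G w|) w0W.
have : w \in P i :\: (nbr G u :|: nbr G v) by [].
rewrite in_setD in_setU negb_or => /andP[/andP[nuw nvw] wi].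
exists w; split=> //; apply/eqP; rewrite eqn_leq (leq_degree o) // andbT.
have h1 := edges_from_neighbours oj uj.
have h2 := edges_from_neighbours ok vk.
have h3 := edges_between_bound o wi.
have h4 := card_edges_at o.
have h5 : #|W| * #|nbr G w| + \sum_(x in nbr_in G u i) deg_in G x k
    + \sum_(x in nbr_in G v i) deg_in G x j <= \sum_(x in P i) #|nbr G x|.
  rewrite [leqRHS](bigID (mem W)) /= -addnA; apply: leq_add.
    rewrite -sum_nat_const [leqRHS](eq_bigl (mem W)) => [|x]; last first.
      by rewrite /= !inE andbC -andbA andbb.
    exact: leq_sum.
  rewrite [leqRHS](eq_bigr (fun x => deg_in G x k + deg_in G x j)); last first.
    by move=> x; case/andP=> xi _; rewrite addnC; apply: (card_nbr GH o).
  rewrite big_split; apply: leq_add; rewrite big_mkcond [leqRHS]big_mkcond.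
    apply: leq_sum => x _; case: ifP => //; rewrite in_setI => /andP[xu xi].
    by rewrite ifT // in_setD in_setU xu /= andbT.
  apply: leq_sum => x _; case: ifP => //; rewrite in_setI => /andP[xv xi].
  by rewrite ifT // in_setD in_setU xv orbT /= andbT.
move: nbig cW h1 h2 h3 h5 h4 Ele.
rewrite (card_nbr GH oj uj) (card_nbr GH ok vk).
exact: low_degree_arith.
Qed.

(** The vertex of least degree. The lower bound that it gives for the edges
    between the two other parts compensates for their share of the edges. *)
Lemma small_degree_largest_part i j k : distinct3 i j k ->
  #|G| <= 2 * m * (n i + n j + n k) -> n j <= n i -> n k <= n i ->
  m * (4 * m + 1) < n i -> exists2 x, x \in P i & #|nbr G x| <= 4 * m.
Proof.
move=> o Ele ji ki big.
have [x0 x0i] : exists x, x \in P i.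
  by apply/card_gt0P; rewrite cardP (leq_trans _ big).
have [x xi xmin] := arg_minnP (fun x => #|nbr G x|) x0i.
exists x => //.
have h1 : n i * #|nbr G x| <= \sum_(w in P i) #|nbr G w|.
  by rewrite -cardP -sum_nat_const; apply: leq_sum.
have h2 := edges_between_bound o xi.
exact: largest_part_arith ji ki big h1 (card_edges_at o) h2 Ele.
Qed.

(** If x misses some z in Z, then it has m neighbours in common with z, all of
    them in Y, so its neighbours in part j outside Y count towards the excess
    of its degree over 2m. If x is joined to all of Z, its excess is at least 1
    because of the m + 1 neighbours in Z; the factor m + 1 then makes up for
    the m neighbours in part j that the excess does not count. A vertex with
    fewer than m neighbours in one of the parts j and k is joined to all of
    the other one and has a large excess. *)
Lemma excess_bound i j k (Y Z : {set V}) x : distinct3 i j k -> x \in P i ->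
  Z \subset P k -> m < #|Z| -> (forall z, z \in Z -> nbr_in G z j \subset Y) ->
  m.+2 <= n j -> 2 * m <= n k ->
  #|nbr G x :&: (P j :\: Y)| + m.+1 * (2 * m) <= m.+1 * #|nbr G x|.
Proof.
move=> o xi Zk cZ ZY nj nk.
have o2 : distinct3 i k j by rewrite distinct3C distinct3_rot.
have cE : #|nbr G x :&: (P j :\: Y)| + #|nbr_in G x j :&: Y| = deg_in G x j.
  by rewrite addnC setIDA cardsID.
rewrite (card_nbr GH o xi); apply: excess_arith => //.
  by rewrite -cE leq_addr.
have [Zx|] := boolP (Z \subset nbr G x).
  have h : m < deg_in G x k.
    apply: (leq_trans cZ); apply: subset_leq_card.
    by rewrite subsetI Zx.
  have [?|->] := deg_or_full o2 xi; first by apply: Or43.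
  exact: Or44.
case/subsetPn=> z zZ nxz; have zk := subsetP Zk z zZ.
have [h1 h2 _] := codegree o2 xi zk nxz.
have h3 : #|nbr G x :&: (P j :\: Y)| + m <= deg_in G x j.
  rewrite -cE leq_add2l (leq_trans h1) // subset_leq_card //.
  apply/subsetP=> w; rewrite !in_setI => /and3P[-> wz wj].
  by rewrite wj (subsetP (ZY z zZ)) // in_setI wz.
have [?|E] := deg_or_full o xi; first by apply: Or41.
by apply: Or42; rewrite E in h3 *.
Qed.

(** At least half of the vertices of part k have at most 8m n_j / n_k neighbours
    in part j, and m + 1 of them have at most n_j / 4 neighbours together. *)
Lemma few_neighbours j k : n k <= n j -> 0 < n k ->
  edges_between G j k <= 2 * m * (n j + n k) ->
  32 * m ^ 2 + 32 * m <= n k ->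
  exists Z : {set V}, [/\ Z \subset P k, #|Z| = m.+1
    & 4 * #|\bigcup_(z in Z) nbr_in G z j| <= n j].
Proof.
move=> kj nk ele big; pose bad z := 8 * m * n j < n k * deg_in G z j.
have hb : 2 * #|[set z in P k | bad z]| <= n k.
  apply: (@few_bad_arith m (n j) _ (edges_between G k j)) => //.
  - exact: leq_trans kj.
  - rewrite -sum_nat_const /edges_between big_distrr /=.
    rewrite [leqRHS](bigID bad) /=; apply: (leq_trans _ (leq_addr _ _)).
    rewrite [leqRHS](eq_bigl (mem [set z in P k | bad z])) => [|z]; last first.
      by rewrite /= !inE.
    by apply: leq_sum => z; rewrite inE => /andP[_ /ltnW].
  - by rewrite edges_betweenC.
have hg : m < #|P k :\: [set z in P k | bad z]|.
  have := cardsID [set z in P k | bad z] (P k); rewrite cardP.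
  have -> : P k :&: [set z in P k | bad z] = [set z in P k | bad z].
    by apply/setIidPr/subsetP=> z; rewrite inE => /andP[].
  move: hb big nk m_gt0; move: #|_| #|_| (n k) => p q r.
  by clear; rewrite expnS expn1; lia.
have /card_geqP[s [us ss sP]] := hg.
exists [set z in s]; split.
- by apply/subsetP=> z; rewrite inE => /sP; rewrite in_setD => /andP[].
- by rewrite cardsE; rewrite -ss; apply/card_uniqP.
apply: quarter_arith big nk _.
apply: (@leq_trans (\sum_(z in [set z in s]) n k * deg_in G z j)).
  by rewrite -big_distrr leq_mul2l leq_card_bigcup orbT.
have -> : m.+1 = #|[set z in s]| by rewrite cardsE -ss; apply/esym/card_uniqP.
rewrite -sum_nat_const; apply: leq_sum => z; rewrite inE => /sP.
by rewrite !inE => /andP[+ zk]; rewrite zk /= -leqNgt.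
Qed.

(** With Z and Y as in [excess_bound], the edges from part j outside Y to part i
    number at most m + 1 times the excess of the degrees in part i over 2m,
    and this excess is bounded because at least about m(n j + n k) of the
    edges lie between the parts j and k. *)
Lemma small_degree_middle_part i j k x : distinct3 i j k ->
  #|G| <= 2 * m * (n i + n j + n k) -> n j <= n i -> n k <= n j ->
  32 * m ^ 3 + 40 * m ^ 2 + 11 * m <= n k ->
  x \in P i -> #|nbr G x| <= 4 * m ->
  exists2 y, y \in P j & #|nbr G y| <= 10 * m ^ 2 + 5 * m.
Proof.
move=> o Ele ji kj big xi dx.
have [_ bk1 bk2 bk3] := part_size_bounds m_gt0 big.
have nk0 : 0 < n k := leq_trans (ltn0Sn _) bk2.
have bj := leq_trans bk2 kj.
have hE := card_edges_at o.
have Si : 2 * m * n i <= \sum_(w in P i) #|nbr G w|.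
  rewrite mulnC -cardP -sum_nat_const; apply: leq_sum => w wi.
  exact: leq_degree o wi (leq_trans bk3 kj).
have ele : edges_between G j k <= 2 * m * (n j + n k).
  rewrite -(leq_add2l (2 * m * n i)) -mulnDr addnA; apply: leq_trans Ele.
  by rewrite hE leq_add2r.
have [Z [Zk cZ cY]] := few_neighbours kj nk0 ele bk1.
set Y := \bigcup_(z in Z) nbr_in G z j in cY.
have cPY : n j - #|Y| <= #|P j :\: Y|.
  rewrite leq_subLR -cardP -(cardsID Y) leq_add2r subset_leq_card //.
  exact: subsetIr.
have [y0 y0P] : exists y, y \in P j :\: Y.
  apply/card_gt0P; apply: leq_trans cPY; rewrite subn_gt0.
  by move: cY bj; move: #|Y| (n j) => p q; clear; lia.
have [y yP ymin] := arg_minnP (fun y => #|nbr G y|) y0P.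
have yj : y \in P j by apply: (subsetP (subsetDl (P j) Y)).
exists y => //.
have oj : distinct3 j i k by rewrite -distinct3C.
have s1E : \sum_(w in P i) #|nbr G w :&: (P j :\: Y)|
  = \sum_(w in P j :\: Y) deg_in G w i by exact: card_sum_nbr.
apply: (@middle_part_arith _ _ _ _ _ _ _ _ _
  (\sum_(w in P i) #|nbr G w :&: (P j :\: Y)|) m_gt0 kj _ cY _ _ hE _ Ele).
- exact: leq_trans (leqW (leqnSn _)) bj.
- have : \sum_(w in P i) (#|nbr G w :&: (P j :\: Y)| + m.+1 * (2 * m))
      <= \sum_(w in P i) (m.+1 * #|nbr G w|).
    apply: leq_sum => w wi.
    apply: (excess_bound o wi Zk); rewrite ?cZ // => z zZ.
    exact: (bigcup_sup z).
  by rewrite big_split sum_nat_const /= -big_distrr /= cardP (mulnC (n i)).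
- rewrite s1E; apply: (@leq_trans (\sum_(w in P j :\: Y) #|nbr G w|)).
    rewrite (leq_trans (leq_mul cPY (leqnn _))) // -sum_nat_const.
    by apply: leq_sum => w; apply: ymin.
  have -> : \sum_(w in P j :\: Y) #|nbr G w|
      = \sum_(w in P j :\: Y) (deg_in G w i + deg_in G w k).
    apply: eq_bigr => w; rewrite in_setD => /andP[_ wj].
    exact: card_nbr oj wj.
  rewrite big_split leq_add2l /edges_between [leqRHS](big_setID Y) /=.
  exact: leq_addl.
- rewrite (leq_trans (edges_between_bound o xi)) // leq_add2l.
  by rewrite leq_mul2l dx orbT.
Qed.

(** The two vertices of small degree serve only to find z; x and y are then
    chosen with degree 2m and nonadjacent to the vertices already found. *)
Lemma independent_triple i j k : distinct3 i j k ->
  #|G| <= 2 * m * (n i + n j + n k) -> n j <= n i -> n k <= n j ->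
  32 * m ^ 3 + 40 * m ^ 2 + 11 * m <= n k ->
  exists x y z, [/\ x \in P i, y \in P j & z \in P k] /\
    [/\ y \notin nbr G x, z \notin nbr G x & z \notin nbr G y] /\
    [/\ #|nbr G x| = 2 * m, #|nbr G y| = 2 * m & #|nbr G z| = 2 * m].
Proof.
move=> o Ele ji kj big.
have bigj := leq_trans big kj; have bigi := leq_trans bigj ji.
have [bi _ _ bi2] := part_size_bounds m_gt0 bigi.
have [_ _ _ bj2] := part_size_bounds m_gt0 bigj.
have oj : distinct3 j i k by rewrite -distinct3C.
have ok : distinct3 k i j by rewrite distinct3_rot.
have Elej : #|G| <= 2 * m * (n j + n i + n k) by rewrite [n j + _]addnC.
have Elek : #|G| <= 2 * m * (n k + n i + n j) by rewrite -addnA addnC.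
have small : 2 * m <= 10 * m ^ 2 + 5 * m.
  by rewrite (leq_trans _ (leq_addl _ _)) // leq_mul2r orbT.
have le24 : 2 * m <= 4 * m by rewrite leq_mul2r orbT.
have [x0 x0i dx0] := small_degree_largest_part o Ele ji (leq_trans kj ji) bi.
have [y0 y0j dy0] := small_degree_middle_part o Ele ji kj big x0i dx0.
have [|z [zk nzx0 nzy0 dz]] := low_degree ok x0i y0j Elek bi2.
  by rewrite [#|_| + #|_|]addnC; apply: low_degree_threshold.
have [|y [yj nyx0 nyz dy]] := low_degree oj x0i zk Elej bi2.
  by rewrite [#|_| + #|_|]addnC; apply: low_degree_threshold; rewrite ?dz.
have [|x [xi nxy nxz dx]] := low_degree o yj zk Ele bj2.
  by apply: low_degree_threshold; rewrite ?dz ?dy.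
by exists x, y, z; do 2!(split; first by split=> //; rewrite nbrC); split.
Qed.

(** Each x p has exactly m neighbours in each of the other parts. By the
    codegree bound, x p and x r have the same neighbours in part q, which form
    S q. A vertex v of part p outside S p is not adjacent to x r, so it shares
    m neighbours in part q with x r, and these make up S q. For v in S p, look
    at the copy created by an edge between x p and x q: its class in the third
    part has only m vertices, so its other classes are x p with S p and x q
    with S q. *)
Lemma core_of_triple (x : 'I_3 -> V) :
  (forall p, x p \in P p) -> (forall p q, x q \notin nbr G (x p)) ->
  (forall p, #|nbr G (x p)| = 2 * m) ->
  exists S : 'I_3 -> {set V}, core_choice m S /\
    forall p q v w, p != q -> v \in P p -> w \in S q -> w \in nbr G v.
Proof.
move=> xP xN xd.
have half p q r : distinct3 p q r -> deg_in G (x p) q = m.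
  move=> o; have o2 : distinct3 p r q by rewrite distinct3C distinct3_rot.
  have := card_nbr GH o (xP p); rewrite xd.
  have := codegree_deg_in o (xP p) (xP q) (xN _ _).
  have := codegree_deg_in o2 (xP p) (xP r) (xN _ _).
  by move: (deg_in _ _ _) (deg_in _ _ _) => d1 d2; clear; lia.
have same p q r : distinct3 p q r -> nbr_in G (x p) q = nbr_in G (x r) q.
  move=> o; have o2 : distinct3 p r q by rewrite distinct3C distinct3_rot.
  have o3 : distinct3 r q p by rewrite distinct3C distinct3_rot -distinct3C.
  have [h _ _] := codegree o2 (xP p) (xP r) (xN _ _).
  have E : nbr G (x p) :&: nbr_in G (x r) q
      = nbr_in G (x p) q :&: nbr_in G (x r) q.
    by apply/setP=> v; rewrite !in_setI; do !case: (_ \in _).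
  rewrite E in h.
  have /eqP <- : nbr_in G (x p) q :&: nbr_in G (x r) q == nbr_in G (x p) q.
    by rewrite eqEcard subsetIl -/(deg_in G (x p) q) (half _ _ _ o).
  apply/eqP; rewrite eqEcard subsetIr -/(deg_in G (x r) q) (half _ _ _ o3) //.
(* All nonempty sets of this union are equal. *)
pose S q := \bigcup_p nbr_in G (x p) q.
have SE p q r : distinct3 p q r -> S q = nbr_in G (x p) q.
  move=> o; apply/setP=> v; apply/bigcupP/idP => [[p' _]|]; last by exists p.
  case/or3P: (distinct3_cover p' o) => /eqP -> //.
    rewrite in_setI => /andP[/(nbr_tag GH) + vq]; have := xP q.
    by move: vq; rewrite !inE => /eqP-> /eqP->; rewrite eqxx.
  by rewrite (same _ _ _ o).
exists S; split=> [q|p q v w pq vp wq].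
  have [p pq] : exists p, q != p.
    by case: q => [[|q] ?]; [exists ord_max | exists ord0].
  have [r o] := distinct3_ex pq.
  have o2 : distinct3 p q r by rewrite -distinct3C.
  by rewrite (SE _ _ _ o2); split; [apply: subsetIr | apply: half o2].
have [r o] := distinct3_ex pq.
have o2 : distinct3 p r q by rewrite distinct3C distinct3_rot.
have o3 : distinct3 r q p by rewrite distinct3C distinct3_rot -distinct3C.
have o4 : distinct3 r p q by rewrite distinct3_rot.
have [vS|nvS] := boolP (v \in S p); last first.
  have nv : x r \notin nbr G v.
    by rewrite nbrC; apply: contra nvS => vr; rewrite (SE _ _ _ o4) in_setI vr.
  have [h _ _] := codegree o2 vp (xP r) nv.
  rewrite (SE _ _ _ o3) in wq.
  have /eqP E : nbr G v :&: nbr_in G (x r) q == nbr_in G (x r) q.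
    by rewrite eqEcard subsetIr -/(deg_in G (x r) q) (half _ _ _ o3).
  by rewrite -E in_setI in wq; case/andP: wq.
have [X [Y [Z [[Xp Yq Zr xX xY] [_ _ mZ _ [mXZ mYZ]] [XZ YZ XY]]]]] :=
  saturated_copyP m_gt0 Gsat o (xP p) (xP q) (xN p q).
have cZ : #|Z| <= m.
  rewrite -(half p r q o2); apply: subset_leq_card; apply/subsetP=> z zZ.
  by rewrite in_setI XZ // (subsetP Zr).
have X1 : #|X| = #|X :\ x p|.+1 by rewrite (cardsD1 (x p)) xX.
have Y1 : #|Y| = #|Y :\ x q|.+1 by rewrite (cardsD1 (x q)) xY.
have /eqP EX : X :\ x p == S p.
  have o5 : distinct3 q p r by rewrite -distinct3C.
  rewrite (SE _ _ _ o5) eqEcard -/(deg_in G (x q) p) (half _ _ _ o5).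
  apply/andP; split.
    apply/subsetP=> u; rewrite in_setD1 => /andP[up uX].
    by rewrite in_setI (subsetP Xp) // andbT nbrC XY // xpair_eqE negb_and up.
  by move: X1 mXZ cZ; move: #|X| #|_ :\ _| #|Z| => a1 a2 a3; clear; lia.
have /eqP EY : Y :\ x q == S q.
  rewrite (SE _ _ _ o) eqEcard -/(deg_in G (x p) q) (half _ _ _ o).
  apply/andP; split.
    apply/subsetP=> u; rewrite in_setD1 => /andP[up uY].
    rewrite in_setI (subsetP Yq) // andbT XY // xpair_eqE negb_and.
    by rewrite up orbT.
  by move: Y1 mYZ cZ; move: #|Y| #|_ :\ _| #|Z| => a1 a2 a3; clear; lia.
move: vS wq; rewrite -EX -EY !in_setD1 => /andP[vx vX] /andP[wx wY].
by rewrite XY // xpair_eqE negb_and vx.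
Qed.

End Saturated.

(** * The graph [G3] *)

Lemma other_two_parts (i c : 'I_3) :
  ((c == (i + 1)%R) || (c == (i + 2%:R)%R)) = (c != i).
Proof.
rewrite -!val_eqE; case: i => [[|[|[|?]]] ?] //;
  by case: c => [[|[|[|?]]] ?] //=.
Qed.

Lemma contains_sub (V W : finType) (G G' : graph V) (F : graph W) :
  G \subset G' -> contains G F -> contains G' F.
Proof.
move=> GG' /existsP[f /andP[fi /forall_inP fF]].
apply/existsP; exists f; rewrite fi; apply/forall_inP=> e /fF.
exact: (subsetP GG').
Qed.

Section G3.
Variables a b c m : nat.
Let V := tri_vertex a b c.
Let n := sizes3 a b c.
Let P := part a b c.
Let H := complete_tripartite a b c.
Let F := complete_tripartite m.+1 m.+1 m.
Implicit Types S T : 'I_3 -> {set V}.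

Lemma complete_tripartiteP e : e \in H ->
  exists x y : V, tag x != tag y /\ e = [set x; y].
Proof. by case/imset2P=> x y _; rewrite !inE /= => xy ->; exists x, y. Qed.

Variable S : 'I_3 -> {set V}.
Hypothesis cS : core_choice m S.

Lemma core_tag x i : x \in S i -> tag x = i.
Proof.
by have [/subsetP h _] := cS i => /h; rewrite inE => /eqP.
Qed.

Lemma G3E x y : ([set x; y] \in G3 S) =
  (tag x != tag y) && ((x \in S (tag x)) || (y \in S (tag y))).
Proof.
apply/bigcupP/idP => [[i _ /imset2P[u v uS]]|].
  rewrite !inE other_two_parts => vi E.
  have tu := core_tag uS; rewrite -tu eq_sym in vi; rewrite -tu in uS.
  by case/set2_eq: E => -[-> ->]; rewrite ?vi ?uS ?orbT // eq_sym vi.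
case/andP=> xy /orP[xS|yS]; [exists (tag x) => //|exists (tag y) => //].
  by apply/imset2P; exists x y; rewrite // !inE other_two_parts eq_sym.
apply/imset2P; exists y x; rewrite ?[[set x; y]]setUC //.
by rewrite !inE other_two_parts.
Qed.

Lemma G3_sub : G3 S \subset H.
Proof.
apply/subsetP=> e /bigcupP[i _ /imset2P[x y xS]].
rewrite !inE other_two_parts => yi ->.
by rewrite mem_complete_tripartite (core_tag xS) eq_sym.
Qed.

(** Two classes of a copy have m + 1 vertices, so each of them has a vertex
    outside the core, but the core meets every edge. *)
Lemma G3_free : ~~ contains (G3 S) F.
Proof.
apply/negP; case: (posnP m) => [m0|m_gt0 cF].
  (* For m = 0 the core is empty, so G3 has no edge. *)
  case/existsP=> f /andP[_ /forall_inP fF].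
  pose size i := sizes3 m.+1 m.+1 m i.
  pose i1 : 'I_3 := lift ord0 ord0.
  pose v : tri_vertex m.+1 m.+1 m :=
    Tagged (fun i => 'I_(size i)) (ord0 : 'I_(size ord0)).
  pose w : tri_vertex m.+1 m.+1 m :=
    Tagged (fun i => 'I_(size i)) (ord0 : 'I_(size i1)).
  have := fF [set v; w]; rewrite mem_complete_tripartite => /(_ isT).
  rewrite imsetU !imset_set1 G3E.
  have S0 i : S i = set0 by apply/cards0_eq; have [_ ->] := cS i.
  by rewrite !S0 !inE andbF.
have [k [A [Ap Ac AG]]] := contains_copy m_gt0 G3_sub cF.
have out i : i != k -> exists2 x, x \in A i & x \notin S i.
  move=> ik; apply/subsetPn; apply/negP=> /subset_leq_card.
  by rewrite Ac (negPf ik); have [_ ->] := cS i; rewrite ltnn.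
have [i ki] : exists i, k != i.
  by case: (k) => [[|q] ?]; [exists ord_max | exists ord0].
have [j o] := distinct3_ex ki; case/and3P: o => _ kj ij.
have [|x xA xS] := out i; first by rewrite eq_sym.
have [|y yA yS] := out j; first by rewrite eq_sym.
have := AG i j x y ij xA yA; rewrite G3E.
have /[!inE]/eqP-> := subsetP (Ap _) _ xA.
have /[!inE]/eqP-> := subsetP (Ap _) _ yA.
by rewrite (negPf xS) (negPf yS) andbF.
Qed.

(** For a nonedge xy, the copy consists of the core together with x and y. *)
Lemma G3_saturated : saturated H F (G3 S).
Proof.
apply/and3P; split; [exact: G3_sub | exact: G3_free |].
apply/forall_inP=> e; rewrite in_setD => /andP[eG].
case/complete_tripartiteP=> x [y [xy E]]; subst e.
move: eG; rewrite G3E xy negb_or => /andP[xS yS].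
have [k o] := distinct3_ex xy.
pose A i := S i :|: [set x; y] :&: P i.
have AxE : A (tag x) = x |: S (tag x).
  apply/setP=> v; rewrite !inE orbC; case: eqP => [->|_]; first by rewrite eqxx.
  by case: eqP => [->|//]; rewrite eq_sym (negPf xy).
have AyE : A (tag y) = y |: S (tag y).
  apply/setP=> v; rewrite !inE orbC [(v == x) || _]orbC.
  case: eqP => [->|_]; first by rewrite eqxx.
  by case: eqP => [->|//]; rewrite (negPf xy).
have AkE : A k = S k.
  apply/setP=> v; rewrite !inE; case/and3P: o => _ xk yk.
  case: eqP => [->|_]; first by rewrite (negPf xk) orbF.
  by case: eqP => [->|//] /=; rewrite ?(negPf yk) orbF.
apply: (@copy_contains _ _ _ _ _ k A); split.
- move=> i; rewrite subUset subsetIr andbT; by have [] := cS i.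
- move=> i; case/or3P: (distinct3_cover i o) => /eqP->.
  + case/and3P: o => _ xk _.
    by rewrite (negPf xk) AxE cardsU1 xS; have [_ ->] := cS (tag x).
  + case/and3P: o => _ _ yk.
    by rewrite (negPf yk) AyE cardsU1 yS; have [_ ->] := cS (tag y).
  + by rewrite eqxx AkE; have [_ ->] := cS k.
- move=> i j u v ij uA vA.
  have tu : tag u = i.
    move: uA; rewrite in_setU => /orP[/core_tag //|].
    by rewrite !inE => /andP[_ /eqP].
  have tv : tag v = j.
    move: vA; rewrite in_setU => /orP[/core_tag //|].
    by rewrite !inE => /andP[_ /eqP].
  rewrite in_setU1 G3E tu tv ij /=.
  move: uA vA; rewrite !in_setU !in_setI.
  move=> /orP[->|/andP[uxy _]]; rewrite ?orbT //.
  move=> /orP[->|/andP[vxy _]]; rewrite ?orbT //.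
  move: uxy vxy ij; rewrite -tu -tv !inE.
  by do 2!(case/orP=> /eqP->); rewrite ?eqxx // setUC eqxx.
Qed.

Lemma core_size i : m <= n i.
Proof.
have [h1 <-] := cS i; rewrite -[n i](card_part a b c).
exact: subset_leq_card.
Qed.

Lemma G3_edges_between i j : i != j ->
  edges_between (G3 S) i j = m * n j + (n i - m) * m.
Proof.
move=> ij; have [Si ci] := cS i; have [Sj cj] := cS j.
have tP x k : x \in P k -> tag x = k by rewrite inE => /eqP.
rewrite /edges_between (big_setID (S i)) /= (setIidPr Si); congr (_ + _).
  rewrite -ci -sum_nat_const; apply: eq_bigr => x xS.
  rewrite /deg_in -[n j](card_part a b c); apply: eq_card => y.
  rewrite !inE G3E (core_tag xS) xS andbT.
  by case: (tag y =P j) => [->|_]; rewrite ?ij ?andbF.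
rewrite -[n i](card_part a b c) -{1}ci -(setIidPr Si) -cardsD.
rewrite setDIr setDv set0U -sum_nat_const; apply: eq_bigr => x.
rewrite in_setD => /andP[xS xi]; rewrite /deg_in -[RHS]cj; apply: eq_card => y.
rewrite [LHS]inE nbrE G3E (tP _ _ xi) (negPf xS) /=.
apply/idP/idP => [/andP[/andP[_ yS] /tP ty]|yS]; first by rewrite -ty.
by rewrite (core_tag yS) ij yS (subsetP Sj).
Qed.

Lemma card_G3 : #|G3 S| = 2 * m * (a + b + c) - 3 * m ^ 2.
Proof.
pose i0 : 'I_3 := ord0; pose i1 : 'I_3 := lift ord0 ord0.
pose i2 : 'I_3 := ord_max.
have o : distinct3 i0 i1 i2 by [].
rewrite (card_edges_pairs G3_sub o) !G3_edges_between //.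
have := core_size i2; have := core_size i1; have := core_size i0.
have -> : n i0 = a by [].
have -> : n i1 = b by [].
have -> : n i2 = c by [].
clear; rewrite expnS expn1 => h1 h2 h3.
rewrite -[a](subnK h1) -[b](subnK h2) !addnK.
rewrite -[c](subnK h3).
move: (a - m) (b - m) (c - m) => p q r; lia.
Qed.

End G3.

(** The permutation matches the fibres of f and g over each k in the order of
    their enumerations. *)
Lemma perm_of_fibers (T K : finType) (f g : T -> K) :
  (forall k, #|[set x | f x == k]| = #|[set x | g x == k]|) ->
  exists s : {perm T}, forall x, g (s x) = f x.
Proof.
move=> eq_fg; pose ef x := enum [set y | f y == f x].
pose eg x := enum [set y | g y == f x].
pose h x := nth x (eg x) (index x (ef x)).
have xef x : x \in ef x by rewrite mem_enum inE.
have lt_h x : index x (ef x) < size (eg x).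
  by rewrite -cardE -eq_fg cardE index_mem.
have gh x : g (h x) = f x.
  by have := mem_nth x (lt_h x); rewrite mem_enum inE => /eqP.
have h_inj : injective h.
  move=> x y eq_h; have fxy : f x = f y by rewrite -!gh eq_h.
  have Ef : ef x = ef y by rewrite /ef fxy.
  have Eg : eg x = eg y by rewrite /eg fxy.
  move: eq_h (lt_h x).
  rewrite /h (set_nth_default y x (lt_h x)) Eg => /eqP + ltx.
  rewrite nth_uniq ?enum_uniq ?lt_h // => /eqP eq_i.
  by rewrite -(nth_index x (xef x)) eq_i Ef nth_index.
by exists (perm h_inj) => x; rewrite permE.
Qed.

(** Membership in [G3 S] depends only on the parts of the two vertices and on
    whether they lie in the core, so it suffices to match these data. *)
Lemma G3_isomorphic a b c m (S T : 'I_3 -> {set tri_vertex a b c}) :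
  core_choice m S -> core_choice m T -> isomorphic (G3 S) (G3 T).
Proof.
move=> cS cT; pose cls (R : 'I_3 -> {set tri_vertex a b c}) x :=
  (tag x, x \in R (tag x)).
have clsE R (cR : core_choice m R) k : #|[set x | cls R x == k]|
    = if k.2 then m else sizes3 a b c k.1 - m.
  case: k => i [] /=; have [Ri ci] := cR i.
    rewrite -[RHS]ci; apply: eq_card => x; rewrite inE xpair_eqE eqb_id.
    apply/andP/idP => [[/eqP-> //]|xR]; rewrite (core_tag cR xR); split=> //.
  rewrite -(card_part a b c i) -ci -(setIidPr Ri) -cardsD.
  apply: eq_card => x; rewrite !inE xpair_eqE eqbF_neg andbC.
  by case: eqP => [->|]; rewrite ?andbF.
have [s sE] : exists s : {perm tri_vertex a b c},
    forall x, cls T (s x) = cls S x.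
  by apply: perm_of_fibers => k; rewrite !clsE.
apply/existsP; exists s; rewrite eqEcard; apply/andP; split; last first.
  rewrite card_imset ?(card_G3 cS) ?(card_G3 cT) //.
  by apply: imset_inj; apply: perm_inj.
apply/subsetP=> _ /imsetP[e eS ->].
have /complete_tripartiteP[x [y [_ E]]] := subsetP (G3_sub cS) e eS; subst e.
move: eS; rewrite imsetU !imset_set1 (G3E cS) (G3E cT).
by have [-> ->] := sE x; have [-> ->] := sE y.
Qed.

(** * Saturated graphs with few edges *)

Lemma saturated_few_edges a b c m (G : graph (tri_vertex a b c)) :
  0 < m -> b <= a -> c <= b ->
  32 * m ^ 3 + 40 * m ^ 2 + 11 * m <= c ->
  saturated (complete_tripartite a b c) (complete_tripartite m.+1 m.+1 m) G ->
  #|G| <= 2 * m * (a + b + c) ->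
  exists S, core_choice m S /\ G = G3 S.
Proof.
move=> m0 ba cb big Gsat Ele.
pose i0 : 'I_3 := ord0; pose i1 : 'I_3 := lift ord0 ord0.
pose i2 : 'I_3 := ord_max.
have o : distinct3 i0 i1 i2 by [].
have [x [y [z [[xi yj zk] [[nxy nxz nyz] [dx dy dz]]]]]] :=
  @independent_triple a b c m G m0 Gsat i0 i1 i2 o Ele ba cb big.
pose f (p : 'I_3) := if p == i0 then x else if p == i1 then y else z.
have fi p : [|| p == i0, p == i1 | p == i2] by apply: distinct3_cover.
have GH := saturated_sub Gsat.
have nself w : w \notin nbr G w.
  by apply/negP=> /(nbr_tag GH); rewrite eqxx.
have [|||S [cS SG]] := @core_of_triple a b c m G m0 Gsat f.
- by move=> p; case/or3P: (fi p) => /eqP->.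
- move=> p q; case/or3P: (fi p) => /eqP->; case/or3P: (fi q) => /eqP->;
  by rewrite // nbrC.
- by move=> p; case/or3P: (fi p) => /eqP->.
exists S; split=> //; apply/eqP; rewrite eqEsubset.
have G3G : G3 S \subset G.
  apply/subsetP=> e eS; have eH := subsetP (G3_sub cS) e eS.
  have [u [v [uv E]]] := complete_tripartiteP eH; subst e.
  move: eS; rewrite (G3E cS) uv /= => /orP[uS|vS].
    by rewrite setUC -nbrE; apply: (SG _ _ v u _ _ uS); rewrite ?inE // eq_sym.
  by rewrite -nbrE; apply: (SG _ _ u v uv _ vS); rewrite inE.
rewrite G3G andbT; apply/subsetP=> e eG; apply: contraT => neS.
have /and3P[_ _ /forall_inP satS] := G3_saturated cS.
have /and3P[_ /negP Gfree _] := Gsat; case: Gfree.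
apply: (@contains_sub _ _ (e |: G3 S)).
  by rewrite subUset sub1set eG.
by apply: satS; rewrite in_setD neS (subsetP GH).
Qed.

Theorem theorem6 (l n1 n2 n3 : nat)
  (hl : 0 < l) (hn1 : 0 < n1) (hn2 : 0 < n2) (hn3 : 0 < n3)
  (h12 : n2 <= n1) (h23 : n3 <= n2)
  (hbound : 32 * (l - 1) ^ 3 + 40 * (l - 1) ^ 2 + 11 * (l - 1) <= n3) :
  let H := complete_tripartite n1 n2 n3 in
  let F := complete_tripartite l l (l - 1) in
  let N := 2 * (l - 1) * (n1 + n2 + n3) - 3 * (l - 1) ^ 2 in
  sat H F = N /\
  (forall S : 'I_3 -> {set tri_vertex n1 n2 n3},
     core_choice (l - 1) S ->
     [/\ saturated H F (G3 S),
         #|G3 S| = N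
       & forall G : graph (tri_vertex n1 n2 n3),
           saturated H F G -> #|G| = N -> isomorphic G (G3 S)]).
Proof.
case: l hl hbound => // m _; rewrite subSS subn0 => hbound H F N.
have m3 : m <= n3.
  case: (posnP m) => [->//|m0]; have [_ _ h _] := part_size_bounds m0 hbound.
  exact: leq_trans (leqW (leqnSn _)) h.
have m2 := leq_trans m3 h23; have m1 := leq_trans m2 h12.
have few (G : graph (tri_vertex n1 n2 n3)) : saturated H F G -> #|G| <= N ->
    exists S, core_choice m S /\ G = G3 S.
  move=> Gsat Gle; case: (posnP m) => [m0|m_gt0]; last first.
    apply: saturated_few_edges m_gt0 h12 h23 hbound Gsat _.
    exact: leq_trans Gle (leq_subr _ _).
  have [S cS] := core_choice_exists m1 m2 m3; exists S; split=> //.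
  have N0 : N = 0 by rewrite /N m0 muln0 mul0n sub0n.
  have /eqP := card_G3 cS; rewrite -/N N0 cards_eq0 => /eqP->.
  by apply/eqP; rewrite -cards_eq0 -leqn0 -N0.
split; last first.
  move=> S cS; split; [exact: G3_saturated | exact: card_G3 |].
  move=> G Gsat GN; have [|T [cT ->]] := few G Gsat; first by rewrite GN.
  exact: G3_isomorphic cT cS.
have [S cS] := core_choice_exists m1 m2 m3.
have [[G Gsat E] sat_le] := satP (G3_saturated cS).
have := sat_le _ (G3_saturated cS); rewrite E (card_G3 cS) => Gle.
by have [T [cT ->]] := few G Gsat Gle; apply: card_G3.
Qed.
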